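(* A complex operator system $V$ has an essentially unique complex operator system structure up to conjugates of complete $M$-summands. Precisely: let $V$ be a complex operator system, and suppose that $V$ is given a second complex operator system structure with the same underlying real operator system structure. Then there exist two selfadjoint subspaces $X_+$ and $X_-$ of $V$, which are complex subspaces with respect to the first complex structure, each of which is an abstract operator system, such that $V = X_+\oplus^\infty X_-$ completely order isomorphically, and such that the second complex multiplication of $\lambda\in\mathbb{C}$ with $x_++x_-$ is $(\lambda x_+)+(\bar\lambda x_-)$ for all $x_+\in X_+$, $x_-\in X_-$ (the products $\lambda x_+$, $\bar\lambda x_-$ being taken in the first complex structure).
   Context: A real (resp. complex) operator system is a unital selfadjoint real (resp. complex) subspace of $B(H)$ for a real (resp. complex) Hilbert space $H$, considered up to unital complete order isomorphism; it carries matrix cones $M_n(V)^+$. A complex operator system is regarded as a real one by forgetting multiplication by $i$. An abstract operator system is a space with an involution, matrix cones and a unit which is unitally completely order isomorphic to such a concrete one. $X_+\oplus^\infty X_-$ is the operator system direct sum, with componentwise involution, unit $(1_{X_+},1_{X_-})$, and matrix cones $M_n(X_+)^+\oplus M_n(X_-)^+$. A completely order isomorphic identification is one that is a selfadjoint linear bijection which carries the cones at every matrix level onto each other. *)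

(* Defs.v *)
From HB Require Import structures.
From mathcomp Require Import all_boot all_order all_algebra sesquilinear.
From mathcomp Require Import complex boolp classical_sets functions reals.

Set Implicit Arguments.
Unset Strict Implicit.
Unset Printing Implicit Defensive.

Import Order.TTheory GRing.Theory Num.Theory Num.Def.
Local Open Scope classical_set_scope.
Local Open Scope ring_scope.
Local Open Scope complex_scope.

(* Complex Hilbert spaces, with the inner product linear in its first
   argument.  The zero space is allowed: it represents the zero operator
   system, which occurs as a complementary summand of V in V. *)

Definition hnorm (R : realType) (H : lmodType R[i])
  (ip : {dot H for (@conjC R[i])}) (x : H) : R[i] := sqrtC (ip x x).

Definition hilbert_complete (R : realType) (H : lmodType R[i])
    (ip : {dot H for (@conjC R[i])}) : Prop :=
  forall u : nat -> H,
    (forall e : R, 0 < e -> exists N : nat, forall m n : nat,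
       (N <= m)%N -> (N <= n)%N -> hnorm ip (u m - u n) < e%:C) ->
    exists l : H, forall e : R, 0 < e -> exists N : nat, forall n : nat,
       (N <= n)%N -> hnorm ip (u n - l) < e%:C.

Record hilbertSpace (R : realType) := HilbertSpace {
  hcarrier :> lmodType R[i];
  inner : {dot hcarrier for (@conjC R[i])};
  inner_complete : hilbert_complete inner
}.

Definition bounded_operator (R : realType) (H : hilbertSpace R)
    (T : H -> H) : Prop :=
  linear T /\
  exists k : R, forall x, hnorm (inner H) (T x) <= k%:C * hnorm (inner H) x.

Definition is_adjoint (R : realType) (H : hilbertSpace R)
    (T T' : H -> H) : Prop :=
  forall x y, inner H (T x) y = inner H x (T' y).

(* Positivity of an n x n matrix of operators, as an operator on H^n.
   On R[i], [0 <= z] means that z is real and nonnegative. *)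
Definition positive_opmx (R : realType) (H : hilbertSpace R) (n : nat)
    (A : 'I_n -> 'I_n -> H -> H) : Prop :=
  forall x : 'I_n -> H, 0 <= \sum_(i < n) inner H (\sum_(j < n) A i j (x j)) (x i).

Record concrete_opsys (R : realType) (H : hilbertSpace R)
    (S : set (H -> H)) : Prop := ConcreteOpsys {
  copsys_bounded : forall T, S T -> bounded_operator T;
  copsys_unit : S id;
  copsys_linear : forall (a : R[i]) T T', S T -> S T' ->
    S (fun x => a *: T x + T' x);
  copsys_selfadj : forall T, S T -> exists2 T', S T' & is_adjoint T T'
}.

(* An involution, a unit and matrix cones.  Scalar multiplication is not part
   of this record, so that the same data can be considered together with
   several complex structures. *)
Record opsysData (V : zmodType) := OpsysData {
  os_star : V -> V;
  os_unit : V;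
  os_cone : forall n : nat, set 'M[V]_n
}.

Definition abstract_opsys (R : realType) (V : lmodType R[i])
    (D : opsysData V) : Prop :=
  exists (H : hilbertSpace R) (S : set (H -> H)) (f : V -> (H -> H)),
    concrete_opsys S /\
    [/\ set_bij setT S f,
        forall (a : R[i]) u v, f (a *: u + v) = (fun x => a *: f u x + f v x),
        forall v, is_adjoint (f v) (f (os_star D v)),
        f (os_unit D) = id
      & forall (n : nat) (A : 'M[V]_n),
          os_cone D A <-> positive_opmx (fun i j => f (A i j))].

Definition unital_complete_order_iso (R : realType) (V W : lmodType R[i])
    (DV : opsysData V) (DW : opsysData W) (f : V -> W) : Prop :=
  [/\ linear f, bijective f,
      forall v, f (os_star DV v) = os_star DW (f v),
      f (os_unit DV) = os_unit DW
    & forall (n : nat) (A : 'M[V]_n), os_cone DV A <-> os_cone DW (map_mx f A)].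

Definition opsys_dsum (V W : zmodType) (DV : opsysData V) (DW : opsysData W) :
    opsysData (V * W)%type :=
  @OpsysData (V * W)%type
    (fun p => (os_star DV p.1, os_star DW p.2))
    (os_unit DV, os_unit DW)
    (fun n (A : 'M[V * W]_n) =>
       os_cone DV (map_mx fst A) /\ os_cone DW (map_mx snd A)).

(* A second complex vector space structure on the additive group of V; the
   alias [rescaled s] is V with s as its scalar multiplication. *)
Record complexScaling (R : realType) (V : zmodType) := ComplexScaling {
  cscale :> R[i] -> V -> V;
  cscaleA : forall a b v, cscale a (cscale b v) = cscale (a * b) v;
  cscale1 : left_id 1 cscale;
  cscaleDr : right_distributive cscale +%R;
  cscaleDl : forall v, {morph cscale^~ v : a b / a + b}
}.

Definition rescaled (R : realType) (V : zmodType)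
  (s : complexScaling R V) : Type := V.

HB.instance Definition _ (R : realType) (V : zmodType)
  (s : complexScaling R V) := GRing.Zmodule.on (rescaled s).
HB.instance Definition _ (R : realType) (V : zmodType)
  (s : complexScaling R V) := GRing.Zmodule_isLmodule.Build R[i] (rescaled s)
    (@cscaleA _ _ s) (@cscale1 _ _ s) (@cscaleDr _ _ s) (@cscaleDl _ _ s).

Definition submod (K : pzRingType) (V : lmodType K) (X : submodClosed V) : Type :=
  {v : V | v \in X}.

HB.instance Definition _ (K : pzRingType) (V : lmodType K)
  (X : submodClosed V) := SubChoice.on (submod X).
HB.instance Definition _ (K : pzRingType) (V : lmodType K)
  (X : submodClosed V) := [SubChoice_isSubLmodule of submod X by <:].

(* Main.v *)
(* Write [J] for the second multiplication by [i].  The cones are stable under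
   conjugation by scalar matrices of either structure.  Conjugating 3 x 3
   positive matrices by diagonal unitaries of both structures, in two different
   orders, moves only one corner entry by the commutator of [i] and [J]; a
   matrix whose entries force that corner shows that [i] and [J] commute.
   Hence [V] splits into the eigenspaces [J = i] and [J = - i], and a scalar
   compression of [[A, J A], [- J A, A]] shows that both eigenprojections
   [(1 -+ i J) / 2] preserve the cones.  Finally, each summand [X], with unit
   [e] and complementary unit [e' = 1 - e], embeds unitally into [V] by
   [x |-> x + phi x e'] for a vector state [phi] of [X]; by Schur's product
   theorem this is a complete order embedding. *)
Require Import Defs.
From HB Require Import structures.
From mathcomp Require Import all_boot all_order all_algebra sesquilinear.
From mathcomp Require Import spectral.
From mathcomp Require Import complex boolp classical_sets functions reals.
From mathcomp Require Import ring.

Set Implicit Arguments.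
Unset Strict Implicit.
Unset Printing Implicit Defensive.

Import Order.TTheory GRing.Theory Num.Theory Num.Def.
Local Open Scope classical_set_scope.
Local Open Scope ring_scope.
Local Open Scope complex_scope.

(** * Schur's product theorem *)

(** Diagonalise [B] by a unitary [P] with eigenvalues [d]: the sum of the entries of the Hadamard
    product becomes the sum over [k] of [d 0 k] times the form of [A] at row [k] of [P]. *)
Lemma schur_product_ge0 (C : numClosedFieldType) (n : nat) (A B : 'M[C]_n) :
  B \is hermsymmx ->
  (forall c : 'I_n -> C, 0 <= \sum_i \sum_j A i j * (conjC (c i) * c j)) ->
  (forall c : 'I_n -> C, 0 <= \sum_i \sum_j B i j * (conjC (c i) * c j)) ->
  0 <= \sum_i \sum_j A i j * B i j.
Proof.
move=> /hermitian_normalmx/orthomx_spectral_subproof[[P d] /= Pu BE] A0 B0.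
have PK k l : \sum_i P k i * conjC (P l i) = (k == l)%:R.
  have /matrixP/(_ k l) := unitarymxP Pu; rewrite !mxE => <-.
  by apply: eq_bigr => i _; rewrite !mxE.
have BijE i j : B i j = \sum_k d 0 k * (conjC (P k i) * P k j).
  rewrite BE invmx_unitary // mul_mx_diag !mxE; apply: eq_bigr => k _.
  by rewrite !mxE mulrA [_ * d 0 k]mulrC.
have d0 k : 0 <= d 0 k.
  (* The eigenvalue [d 0 k] is the form of [B] at the conjugated row [k] of [P]. *)
  suff -> : d 0 k = \sum_i \sum_j B i j * (conjC (conjC (P k i)) * conjC (P k j)).
    exact: B0.
  transitivity (\sum_l d 0 l * ((k == l)%:R * (l == k)%:R)).
    rewrite (bigD1 k) //= eqxx !mulr1 big1 ?addr0 // => l /negbTE lk.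
    by rewrite lk mulr0 mulr0.
  under [RHS]eq_bigr do under eq_bigr do rewrite BijE mulr_suml.
  under [RHS]eq_bigr do rewrite exchange_big.
  rewrite exchange_big; apply: eq_bigr => l _ /=.
  rewrite -!PK mulr_suml mulr_sumr; apply: eq_bigr => i _.
  rewrite mulr_sumr mulr_sumr; apply: eq_bigr => j _.
  by rewrite conjCK; ring.
under eq_bigr do under eq_bigr do rewrite BijE mulr_sumr.
under eq_bigr do rewrite exchange_big.
rewrite exchange_big; apply: sumr_ge0 => k _ /=.
under eq_bigr do under eq_bigr do rewrite mulrCA.
under eq_bigr do rewrite -mulr_sumr.
by rewrite -mulr_sumr mulr_ge0.
Qed.

(** * Inner products *)

Section Inner.
Variables (R : realType) (H : hilbertSpace R).
Implicit Types (x y z : H) (a : R[i]) (T : H -> H).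

Lemma innerDl x y z : inner H (x + y) z = inner H x z + inner H y z.
Proof. exact: linearDl. Qed.

Lemma innerDr x y z : inner H z (x + y) = inner H z x + inner H z y.
Proof. exact: linearDr. Qed.

Lemma innerZl a x y : inner H (a *: x) y = a * inner H x y.
Proof. exact: linearZl_LR. Qed.

Lemma innerZr a x y : inner H x (a *: y) = conjC a * inner H x y.
Proof. exact: linearZr_LR. Qed.

Lemma inner_sumr I (r : seq I) (P : pred I) (F : I -> H) x :
  inner H x (\sum_(i <- r | P i) F i) = \sum_(i <- r | P i) inner H x (F i).
Proof. exact: linear_sumr. Qed.

Lemma inner_suml I (r : seq I) (P : pred I) (F : I -> H) x :
  inner H (\sum_(i <- r | P i) F i) x = \sum_(i <- r | P i) inner H (F i) x.
Proof. exact: linear_sumlz. Qed.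

Lemma innerC x y : inner H x y = conjC (inner H y x).
Proof. by rewrite hermC mul1r. Qed.

Lemma inner_ge0 x : 0 <= inner H x x.
Proof. exact: dnorm_ge0. Qed.

Lemma inner_eq0 x : inner H x x = 0 -> x = 0.
Proof. by move/eqP; rewrite dnorm_eq0 => /eqP. Qed.

Lemma inner_injr x y : (forall z, inner H z x = inner H z y) -> x = y.
Proof.
move=> xy; apply/subr0_eq/inner_eq0.
by rewrite innerDr xy -innerDr subrr linear0r.
Qed.

(** Division by [t] leaves [u <= t * c] for all [t > 0]. This is how a cross term is shown to vanish
    when a positive form is zero at some vector. *)
Lemma quadratic_ge0_linear_eq0 (u c : R[i]) : 0 <= u -> 0 <= c ->
  (forall t : R[i], 0 < t -> 0 <= t ^+ 2 * c - t * u) -> u = 0.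
Proof.
move=> u0 c0 ht; apply/eqP; apply: contraT => un0.
have upos : 0 < u by rewrite lt_def un0.
have d0 : 0 < 2 * (c + 1) by rewrite mulr_gt0 // ltr_wpDl.
(* At this [t] the bound reads [2 * (c + 1) <= c]; the [+ 1] keeps the denominator positive when
   [c = 0]. *)
have t0 : 0 < u / (2 * (c + 1)) by rewrite divr_gt0.
have := ht _ t0; rewrite expr2 -mulrA -mulrBr pmulr_rge0 // subr_ge0.
rewrite mulrAC ler_pdivlMr // ler_pM2l //.
move=> h; suff /lt_geF : c < 2 * (c + 1) by rewrite h.
by rewrite -subr_gt0 (_ : _ - c = c + 2) ?ltr_wpDl //; ring.
Qed.
End Inner.

(* A faithful representation: [abstract_opsys] without the range of [f]. *)
Record opsys_rep (R : realType) (V : lmodType R[i]) (D : opsysData V)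
    (H : hilbertSpace R) (f : V -> H -> H) : Prop := OpsysRep {
  rep_bounded : forall v, bounded_operator (f v);
  rep_linear : forall a u v, f (a *: u + v) = (fun x => a *: f u x + f v x);
  rep_inj : injective f;
  rep_adj : forall v, is_adjoint (f v) (f (os_star D v));
  rep_unit : f (os_unit D) = id;
  rep_cone : forall n (A : 'M[V]_n),
    os_cone D A <-> positive_opmx (fun i j => f (A i j))
}.

(** The concrete system is recovered as [range f]; its closure properties come from those of [V]
    through [f]. *)
Lemma abstract_opsysP (R : realType) (V : lmodType R[i]) (D : opsysData V) :
  abstract_opsys D <-> exists (H : hilbertSpace R) (f : V -> H -> H), opsys_rep D f.
Proof.
split=> [[H [S [f [[Sb S1 Sl Sa] [[fS fi _] fl fa f1 fc]]]]]|[H [f [fb fl fi fa f1 fc]]]].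
  exists H, f; split => // [v|u v]; first by apply: Sb; apply: fS.
  by apply: fi; rewrite inE.
exists H, (range f), f; split; last first.
  by split => //; split => //; move=> u v _ _ /fi.
split=> [_ [v _ <-]//||a _ _ [u _ <-] [v _ <-]|_ [v _ <-]].
- by exists (os_unit D).
- by exists (a *: u + v).
- by exists (f (os_star D v)) => //; exists (os_star D v).
Qed.

(** * Matrix coefficients and cones in a faithful representation *)

Section Rep.
Variables (R : realType) (V : lmodType R[i]) (D : opsysData V).
Variables (H : hilbertSpace R) (f : V -> H -> H) (hf : opsys_rep D f).
Implicit Types (u v w : V) (x y z h : H) (a : R[i]).

Definition coef v x y := inner H (f v x) y.

Lemma coef_unit x y : coef (os_unit D) x y = inner H x y.
Proof. by rewrite /coef (rep_unit hf). Qed.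

Lemma coefD u v x y : coef (u + v) x y = coef u x y + coef v x y.
Proof. by rewrite /coef -[u]scale1r (rep_linear hf) innerDl innerZl !scale1r mul1r. Qed.

Lemma coef0 x y : coef 0 x y = 0.
Proof. by apply: (addrI (coef 0 x y)); rewrite -coefD !addr0. Qed.

Lemma coefZ a v x y : coef (a *: v) x y = a * coef v x y.
Proof.
rewrite -[_ *: _]addr0 /coef (rep_linear hf) innerDl innerZl.
by rewrite -!/(coef _ _ _) coef0 addr0.
Qed.

Lemma coefN v x y : coef (- v) x y = - coef v x y.
Proof. by rewrite -scaleN1r coefZ mulN1r. Qed.

Lemma coefB u v x y : coef (u - v) x y = coef u x y - coef v x y.
Proof. by rewrite coefD coefN. Qed.

Lemma rep_apply_linear v : linear (f v).
Proof. by case: (rep_bounded hf v). Qed.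

Lemma coefDl v x y z : coef v (x + y) z = coef v x z + coef v y z.
Proof. by rewrite /coef -[x]scale1r rep_apply_linear innerDl !scale1r. Qed.

Lemma coef0l v y : coef v 0 y = 0.
Proof. by apply: (addrI (coef v 0 y)); rewrite -coefDl !addr0. Qed.

Lemma coefZl a v x y : coef v (a *: x) y = a * coef v x y.
Proof.
rewrite -[_ *: _]addr0 /coef rep_apply_linear innerDl innerZl.
by rewrite -!/(coef _ _ _) coef0l addr0.
Qed.

Lemma coefZr a v x y : coef v x (a *: y) = conjC a * coef v x y.
Proof. exact: innerZr. Qed.

Lemma coef_suml I (r : seq I) (P : pred I) (F : I -> H) v y :
  coef v (\sum_(i <- r | P i) F i) y = \sum_(i <- r | P i) coef v (F i) y.
Proof.
exact: (big_morph (coef v ^~ y) (fun x1 x2 => coefDl v x1 x2 y) (coef0l v y)).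
Qed.

Lemma coef_sumr I (r : seq I) (P : pred I) (F : I -> H) v x :
  coef v x (\sum_(i <- r | P i) F i) = \sum_(i <- r | P i) coef v x (F i).
Proof. exact: inner_sumr. Qed.

Lemma coef_star v x y : coef (os_star D v) x y = conjC (coef v y x).
Proof. by rewrite /coef innerC -(rep_adj hf). Qed.

Lemma coef_inj u v : (forall x y, coef u x y = coef v x y) -> u = v.
Proof.
move=> uv; apply: (rep_inj hf); apply/funext => x; apply: inner_injr => y.
by rewrite innerC [RHS]innerC -!/(coef _ _ _) uv.
Qed.

Lemma starK v : os_star D (os_star D v) = v.
Proof. by apply: coef_inj => x y; rewrite !coef_star conjCK. Qed.

Lemma star_linear a u v :
  os_star D (a *: u + v) = conjC a *: os_star D u + os_star D v.
Proof.
apply: coef_inj => x y.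
by rewrite coefD coefZ !coef_star coefD coefZ rmorphD rmorphM.
Qed.

Lemma star_unit : os_star D (os_unit D) = os_unit D.
Proof. by apply: coef_inj => x y; rewrite coef_star !coef_unit -innerC. Qed.

Lemma cone_coef n (A : 'M[V]_n) :
  os_cone D A <-> forall x : 'I_n -> H, 0 <= \sum_i \sum_j coef (A i j) (x j) (x i).
Proof.
rewrite (rep_cone hf); split=> hA x; have := hA x; congr (0 <= _);
  by apply: eq_bigr => i _; rewrite inner_suml.
Qed.

Lemma unit_cone1 : os_cone D (const_mx (os_unit D) : 'M_1).
Proof. by apply/cone_coef => x; rewrite !big_ord1 mxE coef_unit inner_ge0. Qed.

Lemma cone1_coef v : os_cone D (const_mx v : 'M_1) -> forall x, 0 <= coef v x x.
Proof. by move=> /cone_coef hv x; have := hv (fun=> x); rewrite !big_ord1 mxE. Qed.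

Lemma cone0 n : os_cone D (0 : 'M_n).
Proof.
apply/cone_coef => x; rewrite big1 // => i _.
by rewrite big1 // => j _; rewrite mxE coef0.
Qed.

Lemma coneD n (A B : 'M[V]_n) : os_cone D A -> os_cone D B -> os_cone D (A + B).
Proof.
move=> /cone_coef hA /cone_coef hB; apply/cone_coef => x.
under eq_bigr do under eq_bigr do rewrite mxE coefD.
by under eq_bigr do rewrite big_split; rewrite big_split addr_ge0.
Qed.

(** This is [C^* A C] for the scalar matrix [C] whose column [k] has the single entry [c k], in row
    [s k]. A non-injective [s] repeats rows and columns of [A]. *)
Definition pullback m n (s : 'I_m -> 'I_n) (c : 'I_m -> R[i]) (A : 'M[V]_n) : 'M[V]_m :=
  \matrix_(k, l) ((conjC (c k) * c l) *: A (s k) (s l)).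

Lemma cone_pullback m n s c (A : 'M[V]_n) :
  os_cone D A -> os_cone D (@pullback m n s c A).
Proof.
move=> /cone_coef hA; apply/cone_coef => x.
(* The test vector is [C x], for [C] the scalar matrix behind [pullback]. *)
have := hA (fun i => \sum_(k | s k == i) c k *: x k); congr (0 <= _).
rewrite [RHS](partition_big s xpredT) //=; apply: eq_bigr => i _.
under eq_bigr do rewrite coef_sumr.
rewrite exchange_big /=; apply: eq_bigr => k /eqP <-.
rewrite [RHS](partition_big s xpredT) //=; apply: eq_bigr => j _.
rewrite coef_suml; apply: eq_bigr => l /eqP <-.
by rewrite mxE coefZ coefZr coefZl mulrA.
Qed.

Definition hermitian_mx n (A : 'M[V]_n) := forall i j, A j i = os_star D (A i j).

Lemma hermitian_pullback m n s c (A : 'M[V]_n) :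
  hermitian_mx A -> hermitian_mx (@pullback m n s c A).
Proof.
move=> hA k l; rewrite !mxE (hA (s k)) -[in RHS](addr0 (_ *: _)) star_linear.
rewrite rmorphM /= conjCK mulrC; apply: coef_inj => x y.
by rewrite coefD coef_star coef0 rmorph0 addr0.
Qed.

(** Compression of a 2 x 2 block matrix by the scalar column [(a, b)]. *)
Lemma cone_block_sum n (a b : R[i]) (A : 'M[V]_(n + n)) : os_cone D A ->
  os_cone D (\matrix_(i, j)
    ((conjC a * a) *: A (lshift n i) (lshift n j) +
     (conjC a * b) *: A (lshift n i) (rshift n j) +
     ((conjC b * a) *: A (rshift n i) (lshift n j) +
      (conjC b * b) *: A (rshift n i) (rshift n j)))).
Proof.
move=> /cone_coef hA; apply/cone_coef => x.
have := hA (fun k =>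
  match fintype.split k with inl i => a *: x i | inr i => b *: x i end).
congr (0 <= _); rewrite big_split_ord /= -big_split; apply: eq_bigr => i _ /=.
rewrite !big_split_ord /= -!big_split; apply: eq_bigr => j _ /=.
rewrite -!/(unsplit (inl _)) -!/(unsplit (inr _)) !unsplitK /= mxE.
by rewrite !coefD !coefZ !coefZr !coefZl; ring.
Qed.

Definition bounding_mx v (N : R[i]) : 'M[V]_2 :=
  \matrix_(i, j) if i == 0 then if j == 0 then os_unit D else v
                 else if j == 0 then os_star D v else N *: os_unit D.

(** Completing the square: the form at [(x0, x1)] is the squared norm of [x0 + f v x1] plus
    [N |x1|^2 - |f v x1|^2], so [N] can be the square of an operator bound for [f v]. *)
Lemma cone_bounding v : exists2 N : R[i], 0 <= N & os_cone D (bounding_mx v N).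
Proof.
have [fl [k hk]] := rep_bounded hf v.
exists (k%:C ^+ 2); first by rewrite -rmorphXn /= ler0c sqr_ge0.
apply/cone_coef => x; rewrite !big_ord_recl !big_ord0 !mxE /= !addr0.
set x0 := x ord0; set x1 := x (lift _ _).
rewrite coefZ coef_star !coef_unit.
have hn0 y : 0 <= hnorm (inner H) y by exact: sqrt_dnorm_ge0.
have : hnorm (inner H) (f v x1) ^+ 2 <= (k%:C * hnorm (inner H) x1) ^+ 2.
  by apply: lerXn2r (hk x1); rewrite nnegrE // (le_trans (hn0 _) (hk x1)).
rewrite exprMn /hnorm !sqrtCK.
rewrite -subr_ge0 => h.
have := addr_ge0 (inner_ge0 (x0 + f v x1)) h; congr (0 <= _).
rewrite !innerDl !innerDr /coef [inner H x0 (f v x1)]innerC.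
by ring.
Qed.

Lemma hermitian_bounding v N : 0 <= N -> hermitian_mx (bounding_mx v N).
Proof.
move=> N0 i j; rewrite !mxE; case: (i == 0); case: (j == 0) => //.
- by rewrite star_unit.
- by rewrite starK.
apply: coef_inj => x y; rewrite coef_star !coefZ !coef_unit rmorphM /= -innerC.
by rewrite geC0_conj.
Qed.

(* The positive form vanishes at [(-h, h, 0)], so its cross term with
   [(0, 0, z)] vanishes too. *)
Lemma cone_eq_corner (A : 'M[V]_3) : os_cone D A -> hermitian_mx A ->
    (forall i j : 'I_3, (i < 2)%N -> (j < 2)%N -> A i j = os_unit D) ->
  A 0 ord_max = A 1 ord_max.
Proof.
move=> /cone_coef hA hh h1; apply/subr0_eq/coef_inj => z y; rewrite coef0.
have sum3 (F : 'I_3 -> R[i]) : \sum_i F i = F 0 + F 1 + F ord_max.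
  by rewrite !big_ord_recr big_ord0 /= add0r; congr (F _ + F _ + F _); apply: val_inj.
(* With this [h] the cross term of [(- h, h, 0)] with [(0, 0, z)] is minus [inner H h h]. *)
set w := _ - _; pose h := f w z.
suff h0 : h = 0 by rewrite /coef -/h h0 linear0l.
have c0 : 0 <= coef (A ord_max ord_max) z z.
  have := hA (fun i => if i == ord_max then z else 0); congr (0 <= _).
  by rewrite !sum3 /= !coef0l /coef !linear0r !add0r.
have u0 : 0 <= 2 * inner H h h by rewrite mulr_ge0 ?inner_ge0.
suff /eqP : 2 * inner H h h = 0.
  by rewrite mulf_eq0 pnatr_eq0 /= => /eqP/inner_eq0.
apply: quadratic_ge0_linear_eq0 u0 c0 _ => t t0.
have ct : conjC t = t by rewrite geC0_conj // ltW.
(* The block of units contributes nothing at [(- h, h, t *: z)], so the form equals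
   [t ^+ 2 * c - t * u] with [u = 2 * inner H h h]. *)
have := hA (fun i => if i == ord_max then t *: z else if i == 0 then - h else h).
congr (0 <= _); rewrite !sum3 /= (hh 0 ord_max) (hh 1 ord_max).
rewrite (h1 0 0) // (h1 0 1) // (h1 1 0) // (h1 1 1) //.
have hN u x : (coef u x (- h) = - coef u x h) * (coef u (- h) x = - coef u h x).
  by rewrite -scaleN1r coefZr coefZl rmorphN1 !mulN1r.
have hw : coef (A 0 ord_max) z h - coef (A 1 ord_max) z h = inner H h h.
  by rewrite -coefB.
rewrite !hN !coefZl !coefZr !coef_star ct !coef_unit.
have hw' : conjC (coef (A 0 ord_max) z h) - conjC (coef (A 1 ord_max) z h) = inner H h h.
  by rewrite -rmorphB hw; exact/esym/innerC.
have -> : 2 * inner H h h = coef (A 0 ord_max) z h - coef (A 1 ord_max) z h +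
    (conjC (coef (A 0 ord_max) z h) - conjC (coef (A 1 ord_max) z h)).
  by rewrite hw hw' mulr_natl.
by ring.
Qed.
End Rep.

(** * Two complex structures on the same cones *)

Section TwoScalings.
Variables (R : realType) (V : lmodType R[i]) (D : opsysData V).
Variables (s : complexScaling R V).
Variables (H : hilbertSpace R) (f : V -> H -> H) (hf : opsys_rep D f).
Variables (K : hilbertSpace R) (g : rescaled s -> K -> K).
Variables (hg : opsys_rep (D : opsysData (rescaled s)) g).

Lemma conjCi : conjC ('i : R[i]) = - 'i.
Proof. by apply/eqP; rewrite eq_complex /= oppr0 !eqxx. Qed.

Lemma mulii : 'i * 'i = -1 :> R[i].
Proof. by rewrite -expr2 sqr_i. Qed.

(* [G3] comes from [[1,1,w],[1,1,w],[w*,w*,N]] by conjugating with diag(1,i,1)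
   in the first structure, diag(1,1,i) in the second one and diag(1,-i,1) in
   the first one.  Its upper left block consists of ones, so its entries [J w]
   and [i J (- i w)] in the last column agree. *)
Lemma scale_cscale_i v : 'i *: s 'i v = s 'i ('i *: v).
Proof.
suff key w : s 'i w = 'i *: s 'i (- 'i *: w).
  by rewrite (key ('i *: v)) scalerA mulNr mulii opprK scale1r.
have [N N0 hN] := cone_bounding hf w.
pose mid (c : R[i]) (k : 'I_3) : R[i] := if k == 1 then c else 1.
pose end_ (k : 'I_3) : R[i] := if k == ord_max then 'i else 1.
(* [fold] repeats the unit row and column of the 2 x 2 bounding matrix of [w], which gives the 3 x 3
   matrix to be conjugated. *)
pose fold (k : 'I_3) : 'I_2 := if k == ord_max then 1 else 0.
pose G1 := pullback fold (mid 'i) (bounding_mx D w N).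
pose G2 : 'M[V]_3 := @pullback R (rescaled s) 3 3 id end_ G1.
pose G3 : 'M[V]_3 := pullback id (mid (- 'i)) G2.
have hG1 : os_cone D G1 by apply: (cone_pullback hf).
have hG2 : os_cone D G2 by exact: (cone_pullback hg id end_ hG1).
have hG3 : os_cone D G3 by exact: (cone_pullback hf _ _ hG2).
have sG1 : hermitian_mx D G1.
  by apply: (hermitian_pullback hf); exact: (hermitian_bounding hf).
have sG2 : hermitian_mx D G2 by exact: (hermitian_pullback hg id end_ sG1).
have sG3 : hermitian_mx D G3 by exact: (hermitian_pullback hf id _ sG2).
have G3E k l : G3 k l = (conjC (mid (- 'i) k) * mid (- 'i) l) *:
    s (conjC (end_ k) * end_ l)
      ((conjC (mid 'i k) * mid 'i l) *: bounding_mx D w N (fold k) (fold l)).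
  by rewrite !mxE.
have := cone_eq_corner hf hG3 sG3; rewrite !G3E.
rewrite /mid /end_ /fold !mxE /= !rmorph1 !mul1r !scale1r rmorphN /= conjCi opprK !mulr1.
(* It remains to see that the upper left block of [G3] consists of units: there [end_] is 1, and the
   conjugations by ['i] and [- 'i] cancel. *)
apply => k l k2 l2; rewrite !G3E.
have end1 (m : 'I_3) : (m < 2)%N -> end_ m = 1 /\ fold m = 0.
  by move=> m2; rewrite /end_ /fold; case: eqP => // mE; rewrite mE in m2.
have [-> ->] := end1 _ k2; have [-> ->] := end1 _ l2.
rewrite rmorph1 mulr1 cscale1 scalerA mulrACA -rmorphM.
have mid1 m : mid (- 'i) m * mid 'i m = 1.
  by rewrite /mid; case: eqP; rewrite ?mulr1 // mulNr mulii opprK.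
by rewrite !mid1 rmorph1 mulr1 scale1r mxE.
Qed.

(* With [J = s 'i], compress the positive matrix [[A, J A], [- J A, A]], which is
   a conjugate of [[A, A], [A, A]] in the second structure, by (1, e) / 2. *)
Lemma cone_half_sum n (A : 'M[V]_n) (e : R[i]) : e ^+ 2 = - 1 -> os_cone D A ->
  os_cone D (map_mx (fun v => 2^-1 *: (v + e *: s 'i v)) A).
Proof.
move=> e2 hA.
(* The nonnegative number [e * conjC e] has square 1, hence equals 1. *)
have ee : e * conjC e = 1.
  have /eqP := congr1 (fun z => z * conjC z) e2.
  rewrite rmorphN rmorph1 mulrNN mulr1 rmorphXn -exprMn sqrf_eq1 => /orP[/eqP //|/eqP h].
  by have := mul_conjC_ge0 e; rewrite h oppr_ge0 ler10.
have ce : conjC e = - e.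
  by rewrite -[LHS]mul1r -[1]opprK -e2 mulNr expr2 -mulrA ee mulr1.
pose fold (k : 'I_(n + n)) := match fintype.split k with inl i => i | inr i => i end.
pose c (k : 'I_(n + n)) : R[i] := match fintype.split k with inl i => 1 | inr i => 'i end.
have foldl i : (fold (lshift n i) = i) * (c (lshift n i) = 1).
  by rewrite /fold /c -/(unsplit (inl i)) unsplitK.
have foldr i : (fold (rshift n i) = i) * (c (rshift n i) = 'i).
  by rewrite /fold /c -/(unsplit (inr i)) unsplitK.
pose B : 'M[V]_(n + n) := @pullback R (rescaled s) _ _ fold c A.
have hB : os_cone D B by exact: (cone_pullback hg fold c hA).
have BE k l : B k l = s (conjC (c k) * c l) (A (fold k) (fold l)) by rewrite !mxE.
clearbody B.
(* As [conjC e = - e], both off-diagonal blocks contribute [e J A / 4] and both diagonal blocks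
   [A / 4]. *)
have := cone_block_sum hf 2^-1 (2^-1 * e) hB.
congr (os_cone D _); apply/matrixP => i j; rewrite !mxE !BE !foldl !foldr.
rewrite !rmorph1 conjCi !mulr1 !mul1r mulNr mulii opprK cscale1.
set x := A i j; have -> : s (- 'i) x = - s 'i x.
  apply/eqP; rewrite -subr_eq0 opprK -cscaleDl addNr.
  by apply/eqP/(addrI (s 0 x)); rewrite -cscaleDl !addr0.
have c2 : conjC (2^-1 : R[i]) = 2^-1 by rewrite geC0_conj // invr_ge0 ler0n.
rewrite rmorphM /= c2 ce scalerN -scaleNr [X in _ + X]addrC addrACA -!scalerDl.
rewrite scalerDr scalerA; congr (_ *: _ + _ *: _).
  transitivity (2^-1 * 2^-1 * (1 - e ^+ 2)); first by ring.
  by rewrite e2; field.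
by field.
Qed.

End TwoScalings.

(** * Summands as abstract operator systems *)

(** The unit is 0, so the identity operator must be 0 as well: the representing space is the zero
    space of row vectors of length 0. *)
Lemma zero_abstract_opsys (R : realType) (V : lmodType R[i]) (D : opsysData V) :
  (forall v : V, v = 0) -> (forall n (A : 'M[V]_n), os_cone D A) ->
  abstract_opsys D.
Proof.
move=> V0 DA; pose ip : {dot 'rV[R[i]]_0 for (@conjC R[i])} := @dotmx R[i] 0.
have hz (x : 'rV[R[i]]_0) : hnorm ip x = 0.
  by rewrite (thinmx0 x) /hnorm linear0l sqrtC0.
have ipC : hilbert_complete ip.
  move=> u _; exists 0 => e e0; exists 0%N => n _.
  by rewrite hz -[0]/(0%:C) ltcR.
pose H := HilbertSpace ipC.
have H0 (x y : H) : x = y by rewrite (thinmx0 (x : 'rV_0)) (thinmx0 (y : 'rV_0)).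
apply/abstract_opsysP; exists H, (fun=> id); split => //.
- move=> v; split=> [a x y|]; first exact: H0.
  by exists 1 => x; rewrite mul1r.
- by move=> a u v; apply/funext => x; apply: H0.
- by move=> u v _; rewrite (V0 u) (V0 v).
move=> n A; split=> // _ x; rewrite sumr_ge0 // => i _.
by rewrite (H0 (x i) 0) linear0r.
Qed.

(** The embedding is corrected along [e'], which [P] kills: [P] recovers positivity in [X], while
    positivity of the correction term comes from Schur's theorem and [0 <= e']. *)
Lemma summand_abstract_opsys (R : realType) (V : lmodType R[i]) (D : opsysData V)
    (hV : abstract_opsys D) (P : {linear V -> V}) (X : submodClosed V)
    (DX : opsysData (submod X)) :
  (forall v, P (P v) = P v) -> (forall v, v \in X <-> P v = v) ->
  (forall v, P (os_star D v) = os_star D (P v)) ->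
  (forall n (A : 'M[V]_n), os_cone D A -> os_cone D (map_mx P A)) ->
  (forall n (A : 'M[V]_n), os_cone D A -> os_cone D (map_mx (fun v => v - P v) A)) ->
  (forall x : submod X, \val (os_star DX x) = os_star D (\val x)) ->
  \val (os_unit DX) = P (os_unit D) ->
  (forall n (A : 'M[submod X]_n), os_cone DX A <-> os_cone D (map_mx \val A)) ->
  abstract_opsys DX.
Proof.
move=> PK XP Pstar Pcone Qcone DXstar DXunit DXcone.
have /abstract_opsysP[H [f hf]] := hV.
have PX (x : submod X) : P (\val x) = \val x by apply/XP; exact: (svalP x).
have coneP1 v : os_cone D (const_mx v : 'M_1) -> os_cone D (const_mx (P v) : 'M_1).
  by move=> /Pcone; rewrite map_const_mx.
set e := P (os_unit D).
have e_ge0 := cone1_coef hf (coneP1 _ (unit_cone1 hf)).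
(* A vector with nonzero coefficient of [e] provides the state; if there is none, [X] is zero. *)
have [[h he]|noh] := pselect (exists h, coef f e h h != 0); last first.
  have eh0 h : coef f e h h = 0.
    by apply/eqP; apply: contrapT => /negP he; apply: noh; exists h.
  have X0 (x : submod X) : x = 0.
    apply/val_inj/(coef_inj hf) => y z; rewrite (coef0 hf).
    (* [P] sends the bounding matrix of [x] to [[[e, x], [x*, N e]]], whose diagonal forms vanish;
       at [(- f x y, y)] the form is minus twice the squared norm of [f x y]. *)
    have [N N0 /Pcone/(cone_coef hf) hN] := cone_bounding hf (\val x).
    suff fy : f (\val x) y = 0 by rewrite /coef fy linear0l.
    apply: inner_eq0; apply/eqP; rewrite eq_le inner_ge0 andbT.
    have := hN (fun i => if i == 0 then - f (\val x) y else y).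
    rewrite !big_ord_recl !big_ord0 !mxE /= !addr0 linearZ_LR /= (coefZ hf) Pstar !PX.
    rewrite (coef_star hf) !eh0 add0r mulr0 addr0.
    rewrite -scaleN1r coefZr rmorphN1 mulN1r rmorphN -opprD oppr_ge0.
    by rewrite /coef /= -innerC -mulr2n pmulrn_lle0.
  apply: zero_abstract_opsys => // n A; apply/DXcone.
  suff -> : map_mx \val A = 0 by exact: (cone0 hf n).
  by apply/matrixP => i j; rewrite !mxE (X0 (A i j)).
set e' := os_unit D - e.
(* The normalisation gives [phi e = 1], so that the unit [e] of [X] goes to [e + e' = os_unit D]. *)
pose phi v := coef f v h h / coef f e h h.
(* [e] need not be a projection on [H], so [f] is corrected by a state on [X]. *)
pose iota (x : submod X) : V := \val x + phi (\val x) *: e'.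
have Pe' : P e' = 0 by rewrite /e' linearB /= PK subrr.
have e'_star : os_star D e' = e'.
  rewrite /e' addrC -scaleN1r (star_linear hf) rmorphN1 (star_unit hf) -/e.
  by rewrite /e -Pstar (star_unit hf).
have phi_conj v : phi (os_star D v) = conjC (phi v).
  rewrite /phi (coef_star hf) rmorphM fmorphV /=; congr (_ / _).
  by rewrite geC0_conj // e_ge0.
(* This left inverse yields injectivity and, since [P] preserves the cones, reflection of
   positivity. *)
have Piota x : P (iota x) = \val x by rewrite linearD linearZ /= Pe' scaler0 addr0 PX.
have iota_star x : iota (os_star DX x) = os_star D (iota x).
  by rewrite /iota DXstar phi_conj [\val x + _]addrC (star_linear hf) e'_star addrC.
apply/abstract_opsysP; exists H, (f \o iota); split.
- by move=> x; exact: rep_bounded hf _.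
- move=> a x y /=; rewrite -(rep_linear hf); congr f.
  have vl : \val (a *: x + y) = a *: \val x + \val y by rewrite linearP.
  rewrite /iota vl /phi (coefD hf) (coefZ hf) mulrDl -mulrA.
  by rewrite scalerDl -scalerA addrACA -scalerDr.
- move=> x y /= /(rep_inj hf) xy; apply: val_inj.
  by rewrite /= -Piota xy Piota.
- by move=> x y z /=; rewrite (rep_adj hf) iota_star.
- by rewrite /= /iota DXunit /phi divff // scale1r addrC subrK (rep_unit hf).
move=> n A; rewrite DXcone.
have -> : positive_opmx (fun i j => (f \o iota) (A i j)) <-> os_cone D (map_mx iota A).
  rewrite (rep_cone hf).
  by rewrite (_ : (fun i j => _ (map_mx iota A i j)) = fun i j => (f \o iota) (A i j)) //;
    apply/funext => i; apply/funext => j; rewrite mxE.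
split=> [hA|/Pcone]; last first.
  by congr (os_cone D _); apply/matrixP => i j; rewrite !mxE Piota.
have hA' := hA; move/(cone_coef hf) in hA'.
rewrite (_ : map_mx iota A =
    map_mx \val A + \matrix_(i, j) (phi (\val (A i j)) *: e')); last first.
  by apply/matrixP => i j; rewrite !mxE.
apply: (coneD hf) => //; apply/(cone_coef hf) => x.
have e'_ge0 : forall y, 0 <= coef f e' y y.
  by apply: (cone1_coef hf); have := Qcone _ _ (unit_cone1 hf); rewrite map_const_mx.
(* The form of the correction term at [x] is the sum of the entries of the Hadamard product of these
   two matrices. *)
have := @schur_product_ge0 R[i] n (\matrix_(i, j) phi (\val (A i j)))
  (\matrix_(i, j) coef f e' (x j) (x i)).
under eq_bigr do under eq_bigr do rewrite !mxE.
under [in X in _ -> X]eq_bigr do under eq_bigr do rewrite mxE (coefZ hf).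
apply.
- apply/is_hermitianmxP; rewrite expr0 scale1r; apply/matrixP => i j.
  by rewrite !mxE -(coef_star hf) e'_star.
- move=> c.
  under eq_bigr do under eq_bigr do rewrite mxE.
  have := mulr_ge0 (hA' (fun i => c i *: h)) (_ : 0 <= (coef f e h h)^-1).
  rewrite invr_ge0 e_ge0 => /(_ isT); congr (0 <= _).
  rewrite mulr_suml; apply: eq_bigr => i _; rewrite mulr_suml; apply: eq_bigr => j _.
  by rewrite !mxE coefZr (coefZl hf) /phi; ring.
- move=> c.
  under eq_bigr do under eq_bigr do rewrite mxE.
  have := e'_ge0 (\sum_i c i *: x i); congr (0 <= _).
  rewrite coef_sumr; apply: eq_bigr => i _; rewrite (coef_suml hf).
  apply: eq_bigr => j _; rewrite coefZr (coefZl hf); ring.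
Qed.

(** * Eigenspaces of the second multiplication by ['i] *)

Definition fixed_points (K : pzRingType) (V : lmodType K) (P : {linear V -> V}) :
  {pred V} := fun v => P v == v.

Lemma fixed_points_submod_closed (K : pzRingType) (V : lmodType K)
  (P : {linear V -> V}) : submod_closed (fixed_points P).
Proof.
split=> [|a u v]; rewrite !unfold_in ?linear0 //.
by move=> /eqP Pu /eqP Pv; rewrite linearP Pu Pv.
Qed.

HB.instance Definition _ (K : pzRingType) (V : lmodType K) (P : {linear V -> V}) :=
  GRing.isSubmodClosed.Build K V (fixed_points P) (fixed_points_submod_closed P).

Lemma fixed_pointsP (K : pzRingType) (V : lmodType K) (P : {linear V -> V}) v :
  v \in (fixed_points P : submodClosed V) <-> P v = v.
Proof. by split => [/eqP|/eqP]. Qed.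

Lemma half_double (R : realType) (V : lmodType R[i]) (v : V) :
  (2^-1 : R[i]) *: (v + v) = v.
Proof. by rewrite scalerDr -scalerDl (_ : _ + _ = 1) ?scale1r //; field. Qed.

Section Eigen.
Variables (R : realType) (V : lmodType R[i]) (D : opsysData V).
Variables (s : complexScaling R V).
Variables (hV : abstract_opsys D) (hs : @abstract_opsys R (rescaled s) D).
Hypothesis hreal : forall (r : R) (v : V), s r%:C v = r%:C *: v.

(** Split [a] into real and imaginary parts: the structures agree on real scalars, and the case of
    ['i] is [scale_cscale_i]. *)
Lemma scale_cscale a v : a *: s 'i v = s 'i (a *: v).
Proof.
have /abstract_opsysP[H [f hf]] := hV; have /abstract_opsysP[K [g hg]] := hs.
have r r w : r%:C *: s 'i w = s 'i (r%:C *: w).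
  by rewrite -!hreal !cscaleA mulrC.
by rewrite [a]complexE !scalerDl cscaleDr -!scalerA !r (scale_cscale_i hf hg).
Qed.

(** For [e ^+ 2 = -1] this projects onto the eigenspace of [J = s 'i] for the eigenvalue [- e]; note
    the sign. *)
Definition eigenproj (e : R[i]) v := 2^-1 *: (v + e *: s 'i v).

Lemma eigenproj_linear e : linear (eigenproj e).
Proof.
move=> a u v; rewrite /eigenproj cscaleDr -scale_cscale [e *: (_ + _)]scalerDr.
rewrite (scalerA e) [e * a]mulrC -scalerA addrACA -scalerDr.
by rewrite [2^-1 *: (_ + _)]scalerDr (scalerA 2^-1) [2^-1 * a]mulrC -scalerA.
Qed.

Lemma eigenprojD e v : eigenproj e v + eigenproj (- e) v = v.
Proof.
rewrite /eigenproj -scalerDr scaleNr addrACA subrr addr0.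
exact: half_double.
Qed.

Lemma eigenprojP e v : e ^+ 2 = -1 -> eigenproj e v = v <-> s 'i v = - e *: v.
Proof.
move=> e2; have ee w : - e *: (e *: w) = w.
  by rewrite scalerA mulNr -expr2 e2 opprK scale1r.
have h0 : (2^-1 : R[i]) != 0 by rewrite invr_eq0 pnatr_eq0.
split=> [Pv|Jv]; last first.
  by rewrite /eigenproj Jv scalerA mulrN -expr2 e2 opprK scale1r half_double.
rewrite -[LHS]ee; congr (_ *: _).
by apply: (addrI v); apply: (scalerI h0); rewrite half_double.
Qed.

Lemma eigenproj_in e v : e ^+ 2 = -1 -> s 'i (eigenproj e v) = - e *: eigenproj e v.
Proof.
move=> e2; rewrite /eigenproj -scale_cscale cscaleDr -scale_cscale cscaleA mulii.
have -> : s (-1) v = - v by rewrite -(rmorphN1 (real_complex R)) hreal rmorphN1 scaleN1r.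
rewrite scalerA [- e * _]mulrC -scalerA; congr (_ *: _).
by rewrite scalerDr scalerA mulNr -expr2 e2 opprK scale1r scalerN scaleNr addrC.
Qed.

Lemma eigenproj_id e v : e ^+ 2 = -1 -> eigenproj e (eigenproj e v) = eigenproj e v.
Proof. by move=> e2; apply/eigenprojP => //; exact: eigenproj_in. Qed.

(** The involution is conjugate-linear in both structures, so the sign changes of [e] and of [J]
    cancel. *)
Lemma eigenproj_star e v : e ^+ 2 = -1 -> conjC e = - e ->
  eigenproj e (os_star D v) = os_star D (eigenproj e v).
Proof.
move=> e2 ce; have /abstract_opsysP[H [f hf]] := hV.
have /abstract_opsysP[K [g hg]] := hs.
have star0 : os_star D 0 = 0.
  by have := star_linear hf (-1) 0 0; rewrite scaler0 addr0 rmorphN1 scaleN1r addNr.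
have starD u w : os_star D (u + w) = os_star D u + os_star D w.
  by have := star_linear hf 1 u w; rewrite rmorph1 !scale1r.
have starZ a w : os_star D (a *: w) = conjC a *: os_star D w.
  by have := star_linear hf a w 0; rewrite star0 !addr0.
have starJ w : os_star D (s 'i w) = - s 'i (os_star D w).
  have := star_linear hg 'i w 0; rewrite star0 !addr0 => ->.
  by rewrite conjCi scaleNr.
rewrite /eigenproj starZ starD starZ starJ ce scaleNr scalerN opprK.
by rewrite geC0_conj // invr_ge0 ler0n.
Qed.

Lemma eigen_summand e : e ^+ 2 = -1 -> conjC e = - e ->
  exists (X : submodClosed V) (DX : opsysData (submod X)),
    [/\ abstract_opsys DX,
        forall v, v \in X <-> eigenproj e v = v,
        forall x, \val (os_star DX x) = os_star D (\val x),
        \val (os_unit DX) = eigenproj e (os_unit D)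
      & forall n (A : 'M_n), os_cone DX A <-> os_cone D (map_mx \val A)].
Proof.
move=> e2 ce; have /abstract_opsysP[H [f hf]] := hV.
have /abstract_opsysP[K [g hg]] := hs.
pose P : {linear V -> V} := HB.pack (eigenproj e)
  (GRing.isLinear.Build _ _ _ _ (eigenproj e) (@eigenproj_linear e)).
pose X : submodClosed V := fixed_points P.
have XP v : v \in X <-> eigenproj e v = v by exact: fixed_pointsP.
have Xstar (x : submod X) : os_star D (\val x) \in X.
  by apply/XP; rewrite eigenproj_star // (iffLR (XP _) (svalP x)).
have Xunit : eigenproj e (os_unit D) \in X by apply/XP; exact: eigenproj_id.
pose DX := @OpsysData (submod X) (fun x => Sub (os_star D (\val x)) (Xstar x))
  (Sub (eigenproj e (os_unit D)) Xunit) (fun n A => os_cone D (map_mx \val A)).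
exists X, DX; split => //.
apply: (@summand_abstract_opsys _ V D hV P X DX) => //.
- by move=> v; exact: eigenproj_id.
- by move=> v; exact: eigenproj_star.
- by move=> n A; exact: (cone_half_sum hf hg e2).
(* The complementary projection is [eigenproj (- e)], to which the same compression applies. *)
move=> n A hA; have := cone_half_sum hf hg (e := - e) _ hA.
rewrite sqrrN => /(_ e2); congr (os_cone D _); apply/matrixP => i j; rewrite !mxE.
by apply/eqP; rewrite eq_sym subr_eq addrC eigenprojD.
Qed.

End Eigen.

(** * Gluing the two eigenspaces *)

Theorem theorem4p4 (R : realType) (V : lmodType R[i]) (D : opsysData V)
    (hV : abstract_opsys D)
    (s : complexScaling R V)
    (hs : @abstract_opsys R (rescaled s) D)
    (hreal : forall (r : R) (v : V), s r%:C v = r%:C *: v) :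
  exists (Xp Xm : submodClosed V)
         (Dp : opsysData (submod Xp)) (Dm : opsysData (submod Xm)),
    [/\ (forall v, v \in Xp -> os_star D v \in Xp) /\
        (forall v, v \in Xm -> os_star D v \in Xm),
        abstract_opsys Dp,
        abstract_opsys Dm,
        unital_complete_order_iso (opsys_dsum Dp Dm) D
          (fun x : submod Xp * submod Xm => \val x.1 + \val x.2)
      & forall (a : R[i]) (xp xm : V), xp \in Xp -> xm \in Xm ->
          s a (xp + xm) = a *: xp + a^* *: xm].
Proof.
have /abstract_opsysP[H [f hf]] := hV; have /abstract_opsysP[K [g hg]] := hs.
have i2 : 'i ^+ 2 = -1 :> R[i] by exact: sqr_i.
have ni2 : (- 'i) ^+ 2 = -1 :> R[i] by rewrite sqrrN.
have ci : conjC ('i : R[i]) = - 'i by exact: conjCi.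
have cni : conjC (- 'i : R[i]) = - - 'i by rewrite rmorphN /= ci.
(* [Xp] is the eigenspace [J = 'i] and hence belongs to [e = - 'i]; [Xm] belongs to [e = 'i]. *)
have [Xp [Dp [absp Xp_P starp unitp conep]]] := eigen_summand hV hs hreal ni2 cni.
have [Xm [Dm [absm Xm_P starm unitm conem]]] := eigen_summand hV hs hreal i2 ci.
have PD v : eigenproj s (- 'i) v + eigenproj s 'i v = v.
  by rewrite addrC eigenprojD.
have Pp v : eigenproj s (- 'i) v \in Xp.
  by apply/Xp_P; exact: (eigenproj_id hV hs hreal _ ni2).
have Pm v : eigenproj s 'i v \in Xm.
  by apply/Xm_P; exact: (eigenproj_id hV hs hreal _ i2).
(* The two projections add up to the identity, so each vanishes on the range of the other. *)
have p_m x : x \in Xm -> eigenproj s (- 'i) x = 0.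
  by move=> /Xm_P xm; apply: (addIr x); rewrite add0r -{2}xm PD.
have m_p x : x \in Xp -> eigenproj s 'i x = 0.
  by move=> /Xp_P xp; apply: (addrI x); rewrite addr0 -{1}xp PD.
have lin e := eigenproj_linear hV hs hreal e.
have eigD e u v : eigenproj s e (u + v) = eigenproj s e u + eigenproj s e v.
  by rewrite -[u]scale1r lin !scale1r.
have pr1 (x : submod Xp * submod Xm) :
    eigenproj s (- 'i) (\val x.1 + \val x.2) = \val x.1.
  by rewrite eigD (p_m _ (svalP x.2)) addr0; apply/Xp_P; exact: (svalP x.1).
have pr2 (x : submod Xp * submod Xm) :
    eigenproj s 'i (\val x.1 + \val x.2) = \val x.2.
  by rewrite eigD (m_p _ (svalP x.1)) add0r; apply/Xm_P; exact: (svalP x.2).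
exists Xp, Xm, Dp, Dm; split => //.
- split=> v vX.
    pose x : submod Xp := Sub v vX.
    have : \val (os_star Dp x) \in Xp by exact: (svalP (os_star Dp x)).
    by rewrite starp.
  pose x : submod Xm := Sub v vX.
  have : \val (os_star Dm x) \in Xm by exact: (svalP (os_star Dm x)).
  by rewrite starm.
- split.
  + by move=> a x y /=; rewrite scalerDr addrACA.
  + exists (fun v => (Sub (eigenproj s (- 'i) v) (Pp v) : submod Xp,
                      Sub (eigenproj s 'i v) (Pm v) : submod Xm)) => [x|v /=]; last by rewrite PD.
    rewrite [RHS]surjective_pairing.
    by congr (_, _); apply: val_inj; rewrite /= ?pr1 ?pr2.
  + move=> x; rewrite /= starp starm.
    by have := star_linear hf 1 (\val x.1) (\val x.2); rewrite rmorph1 !scale1r => ->.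
  + by rewrite /= unitp unitm PD.
  move=> n A /=; rewrite conep conem; split=> [[hp hm]|hA].
    have := coneD hf hp hm; congr (os_cone D _).
    by apply/matrixP => i j; rewrite !mxE.
  (* Both eigenprojections preserve the cones, so positivity of a sum passes to its two
     components. *)
  split; [have := cone_half_sum hf hg ni2 hA|have := cone_half_sum hf hg i2 hA];
    congr (os_cone D _); apply/matrixP => i j;
    by rewrite !mxE -/(eigenproj _ _ _) ?pr1 ?pr2.
(* With [s a = Re a + J (Im a)], the eigenvalue ['i] on [Xp] gives [a], and [- 'i] on [Xm] gives its
   conjugate. *)
move=> a xp xm /Xp_P/(eigenprojP s _ ni2) Jp /Xm_P/(eigenprojP s _ i2) Jm.
have sE v : s a v = (complex.Re a)%:C *: v + s 'i ((complex.Im a)%:C *: v).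
  by rewrite {1}[a]complexE cscaleDl -cscaleA !hreal.
rewrite cscaleDr !sE -!(scale_cscale hV hs hreal) Jp Jm opprK !scalerA -!scalerDl.
by congr (_ *: _ + _ *: _); case: (a) => x y /=; simpc.
Qed.
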